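(* Let $D$ be a division ring and let $n\ge 1$. Let $D[x_1,\dots,x_n]$ be the polynomial ring over $D$ in $n$ central indeterminates. For every left ideal $I$ of $D[x_1,\dots,x_n]$, $$\bigcap_{I\subseteq M} M=\bigcap_{I\subseteq P}P,$$ where the first intersection is taken over all maximal left ideals $M\subset D[x_1,\dots,x_n]$ containing $I$, and the second intersection is taken over all G-left ideals $P\subset D[x_1,\dots,x_n]$ containing $I$.
   Context: All rings are associative and unital. ''Central indeterminates'' means that the $x_i$ commute with each other and with all elements of $D$. An element $a$ of a ring $R$ is integral over a left ideal $I\subseteq R$ if there exist $m\ge 1$ and $r_0,\dots,r_{m-1}\in I$ with $a^m+r_{m-1}a^{m-1}+\cdots+r_1a+r_0=0$ (where $a^0=1$). A left ideal $P$ of $R$ is called a G-left ideal if there exists $a\in R$ such that $a$ is not integral over $P$ but $a$ is integral over every left ideal $J$ of $R$ with $J\supsetneq P$. An intersection over an empty family of left ideals of a ring is understood to be the whole ring. *)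

(* Defs.v *)
From mathcomp Require Import all_boot all_order all_algebra.
From mathcomp Require Import mpoly.
From mathcomp Require Import classical_sets.

Set Implicit Arguments.
Unset Strict Implicit.
Unset Printing Implicit Defensive.

Local Open Scope ring_scope.
Local Open Scope classical_set_scope.

(* unitRingType is noncommutative in general, and already gives 1 != 0. *)
Definition division_ring (D : unitRingType) : Prop :=
  forall x : D, x != 0 -> x \is a GRing.unit.

(* Closure under opposites follows from closure under left multiplication by
   -1. The whole ring is a left ideal. *)
Definition left_ideal (R : nzRingType) (I : set R) : Prop :=
  [/\ I 0,
      forall u v, I u -> I v -> I (u + v) &
      forall r u, I u -> I (r * u)].

Definition maximal_left_ideal (R : nzRingType) (M : set R) : Prop :=
  [/\ left_ideal M,
      M != setT &
      forall J, left_ideal J -> M `<=` J -> J = M \/ J = setT].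

Definition integral_over (R : nzRingType) (I : set R) (a : R) : Prop :=
  exists (m : nat) (r : 'I_m -> R),
    [/\ (1 <= m)%N,
        forall i, I (r i) &
        a ^+ m + \sum_(i < m) r i * a ^+ i = 0].

Definition G_left_ideal (R : nzRingType) (P : set R) : Prop :=
  left_ideal P /\
  exists a : R,
    ~ integral_over P a /\
    forall J, left_ideal J -> P `<` J -> integral_over J a.

(* Main.v *)
(* Let R = D[x_1, ..., x_n].  A maximal left ideal is a G-left ideal with
   witness a = 1.  Conversely, let P be a G-left ideal with witness a.  By the
   Rabinowitsch trick, P and 1 - a y generate a proper left ideal of R[y]; a
   maximal left ideal N above it meets R exactly in P.

   By a theorem of Amitsur and Small, the simple module R[y]/N is finite
   dimensional over D, so it is finitely generated over R.  The intersection of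
   its maximal R-submodules is then proper and stable under y, hence zero, and
   contracting these submodules to R shows that P is an intersection of maximal
   left ideals.

   The Amitsur-Small theorem is proved in a form stable under induction on the
   number of commuting operators, with D replaced by a left Ore domain A and all
   notions taken up to A-torsion.  If an operator x is transcendental at v, then
   S is a torsion-free A[x]-module, of finite rank by induction.  Let L_0 be the
   saturation of a free A[x]-submodule of maximal rank with v in its basis, and
   filter S by L_{m+1} = L_m + sum_j X_j L_m.  Some monic central g in A[x] acts
   injectively on L_1/L_0; finiteness of rank turns injectivity into density of
   the image, density passes from L_{m+1}/L_m to its images under the X_j, and
   density gives back injectivity.  So g is injective on S/L_0, and since g S is
   dense by simplicity, v is, up to A-torsion, a multiple of g in a free module
   where it is a basis vector: this contradicts deg g > 0. *)

From HB Require Import structures.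
Require Import Defs.
From mathcomp Require Import all_boot all_order all_algebra.
From mathcomp Require Import mpoly.
From mathcomp Require Import boolp classical_sets.

Set Implicit Arguments.
Unset Strict Implicit.
Unset Printing Implicit Defensive.

Import GRing.Theory.

Local Open Scope ring_scope.
Local Open Scope classical_set_scope.

(** * Left Ore domains *)

(** The second clause is the left Ore condition: a fraction a b^-1 can be rewritten as u^-1 w. *)
Definition ore_domain (A : nzRingType) :=
  (forall a b : A, a * b = 0 -> a = 0 \/ b = 0) /\
  (forall a b : A, b != 0 -> exists u w, u != 0 /\ u * a = w * b).

Lemma ore_mulf_neq0 (A : nzRingType) (a b : A) :
  ore_domain A -> a != 0 -> b != 0 -> a * b != 0.
Proof.
by case=> dom _ /eqP a0 /eqP b0; apply/eqP => /dom [].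
Qed.

Lemma division_ring_ore (D : unitRingType) : division_ring D -> ore_domain D.
Proof.
move=> hD; split=> [a b ab0|a b b0].
  have [->|/hD aU] := eqVneq a 0; first by left.
  by right; rewrite -[b](mulKr aU) ab0 mulr0.
by exists 1, (a / b); rewrite oner_neq0 mul1r divrK // hD.
Qed.

(** Gaussian elimination without division: the Ore condition clears the last column by
    cross-multiplication, and the multipliers [(u i).1] are nonzero, so a nontrivial relation found
    by induction stays nontrivial. *)
Lemma ore_left_kernel (A : nzRingType) d (C : 'M[A]_(d.+1, d)) :
  ore_domain A -> exists2 b : 'rV[A]_d.+1, b != 0 & b *m C = 0.
Proof.
move=> hA; elim: d C => [|d IH] C.
  exists (const_mx 1); last by apply/matrixP => i [].
  by apply/eqP => /matrixP /(_ 0 0) /eqP; rewrite !mxE oner_eq0.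
have [C0|] := pselect (forall i, C i ord_max = 0).
  have [b b0 bC] := IH (\matrix_(i, j) C (lift ord_max i) (lift ord_max j)).
  exists (\row_i oapp (b 0) 0 (unlift ord_max i)).
    case/rV0Pn: b0 => i bi; apply/rV0Pn; exists (lift ord_max i).
    by rewrite mxE liftK.
  apply/rowP => j; rewrite !mxE (bigD1_ord ord_max) //= !mxE unlift_none mul0r.
  rewrite add0r; case: (unliftP ord_max j) => [j'|] ->; last first.
    by apply: big1 => i _; rewrite C0 mulr0.
  move/rowP: bC => /(_ j'); rewrite !mxE => bC0; rewrite -[RHS]bC0.
  by apply: eq_bigr => i _; rewrite !mxE liftK.
case/existsNP => p /eqP Cp.
have /choice [u hu] (i : 'I_d.+1) : exists u : A * A,
    u.1 != 0 /\ u.1 * C (lift p i) ord_max = u.2 * C p ord_max.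
  by have [x [y [x0 xy]]] := hA.2 (C (lift p i) ord_max) _ Cp; exists (x, y).
have [b b0 bC] := IH (\matrix_(i, j)
  ((u i).1 * C (lift p i) (lift ord_max j) - (u i).2 * C p (lift ord_max j))).
(* The entry at the pivot row [p] collects the multiples of that row that were subtracted from the
   others. *)
exists (\row_i oapp (fun i => b 0 i * (u i).1) (- \sum_k b 0 k * (u k).2)
          (unlift p i)).
  case/rV0Pn: b0 => i bi; apply/rV0Pn; exists (lift p i).
  by rewrite mxE liftK /=; apply: ore_mulf_neq0 => //; case: (hu i).
apply/rowP => j; rewrite !mxE (bigD1_ord p) //= !mxE unlift_none /=.
rewrite mulNr mulr_suml addrC.
have -> : \sum_(i < d.+1) (\row_i0 oapp (fun i1 => b 0 i1 * (u i1).1)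
    (- (\sum_k b 0 k * (u k).2)) (unlift p i0)) 0 (lift p i) * C (lift p i) j =
    \sum_(i < d.+1) b 0 i * (u i).1 * C (lift p i) j.
  by apply: eq_bigr => i _; rewrite !mxE liftK.
transitivity (\sum_(i < d.+1) b 0 i *
    ((u i).1 * C (lift p i) j - (u i).2 * C p j)).
  by rewrite -sumrB; apply: eq_bigr => i _; rewrite mulrBr !mulrA.
case: (unliftP ord_max j) => [j'|] ->.
  move/rowP: bC => /(_ j'); rewrite !mxE => bC; rewrite -[RHS]bC.
  by apply: eq_bigr => i _; rewrite !mxE.
by apply: big1 => i _; rewrite (hu i).2 subrr mulr0.
Qed.

(** The Ore condition is a dimension count: the X^i f with i < size g and the X^j g with j < size f
    are size f + size g polynomials with one coefficient fewer, hence dependent over [A]. *)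
Lemma ore_domain_poly (A : nzRingType) : ore_domain A -> ore_domain {poly A}.
Proof.
move=> hA; have dom (f g : {poly A}) : f != 0 -> g != 0 -> f * g != 0.
  move=> f0 g0; rewrite -size_poly_eq0 size_proper_mul; last first.
    by apply: ore_mulf_neq0; rewrite ?lead_coef_eq0.
  move: f0 g0; rewrite -!size_poly_gt0.
  by case: (size f) => // m; case: (size g) => // k _ _; rewrite addnS.
split=> [f g fg|f g g0].
  have [->|f0] := eqVneq f 0; first by left.
  have [->|g0] := eqVneq g 0; first by right.
  by have := dom _ _ f0 g0; rewrite fg eqxx.
have [->|f0] := eqVneq f 0; first by exists 1, 0; rewrite oner_neq0 mulr0 mul0r; split.
have fs : (0 < size f)%N by rewrite size_poly_gt0.
have gs : (0 < size g)%N by rewrite size_poly_gt0.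
pose h (i : nat) := if (i < size g)%N then 'X^i * f else 'X^(i - size g) * g.
pose d := (size f + size g).-1.
have dE : d.+1 = (size g + size f)%N by rewrite addnC prednK // addn_gt0 fs.
have [b b0 bh] := ore_left_kernel (\matrix_(i < d.+1, j < d) (h i)`_j) hA.
have sh i : (i < d.+1)%N -> (size (h i) <= d)%N.
  rewrite dE /h => id; case: ltnP => ig; apply: leq_trans (size_polyMleq _ _) _;
  rewrite size_polyXn addSn -ltnS dE /=.
    by rewrite ltn_add2r.
  by rewrite addnC ltn_add2l ltn_subLR.
have hb : \sum_(i < d.+1) (b 0 i)%:P * h i = 0.
  apply/polyP => j; rewrite coef0 coef_sum.
  have [jd|jd] := ltnP j d; last first.
    by apply: big1 => i _; rewrite coefCM nth_default ?mulr0 // (leq_trans (sh _ _)).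
  move/rowP: bh => /(_ (Ordinal jd)); rewrite !mxE => bh0; rewrite -[RHS]bh0.
  by apply: eq_bigr => i _; rewrite !mxE coefCM.
pose bb i := if insub i is Some k then b 0 k else 0 : A.
have bbE (i : 'I_d.+1) : bb i = b 0 i by rewrite /bb valK.
pose u := \poly_(i < size g) bb i.
pose w := \poly_(i < size f) bb (size g + i)%N.
have uw : u * f + w * g = 0.
  rewrite -hb; under [RHS]eq_bigr do rewrite -bbE.
  rewrite -(big_mkord xpredT (fun i => (bb i)%:P * h i)) dE.
  rewrite (@big_cat_nat _ _ _ (size g)) ?leq_addr //=; congr (_ + _).
    rewrite big_mkord /u poly_def mulr_suml; apply: eq_bigr => i _.
    by rewrite /h ltn_ord -mul_polyC mulrA.
  rewrite -{1}[size g]add0n big_addn addKn big_mkord /w poly_def mulr_suml.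
  apply: eq_bigr => i _.
  by rewrite /h ltnNge leq_addl /= addnK -mul_polyC mulrA addnC.
exists u, (- w); split; last by rewrite mulNr; apply/eqP; rewrite -addr_eq0 uw.
(* If [u] were 0, then w g = 0 would force w = 0, and every entry of [b] would vanish. *)
apply/eqP => u0; move: uw; rewrite u0 mul0r add0r => wg0.
have w0 : w = 0.
  by have [//|w0] := eqVneq w 0; have := dom _ _ w0 g0; rewrite wg0 eqxx.
case/rV0Pn: b0 => i; case/eqP; rewrite -bbE.
have [ig|ig] := ltnP i (size g).
  by move/polyP: u0 => /(_ i); rewrite coef_poly ig coef0.
move/polyP: w0 => /(_ (i - size g)%N); rewrite coef_poly subnKC // coef0.
by rewrite ltn_subLR // -dE ltn_ord.
Qed.

(** * Submodules and rank up to torsion *)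

Section Saturation.
Variables (A : nzRingType) (S : lmodType A).
Implicit Types (L W : set S) (f g x : S -> S) (U : seq S).

Definition submodule L :=
  [/\ L 0, forall u v, L u -> L v -> L (u + v) & forall a u, L u -> L (a *: u)].

(** For a submodule [L] this says that S / L is torsion-free. *)
Definition saturated L := forall a u, a != 0 -> L (a *: u) -> L u.

(** Taking an intersection gives a saturated submodule over any ring; the Ore condition enters only
    with [sat]. *)
Definition satgen (G : set S) : set S :=
  [set s | forall L, submodule L -> saturated L -> G `<=` L -> L s].

Definition sat L : set S := [set s | exists2 a, a != 0 & L (a *: s)].

Definition linear_op f :=
  (forall u v, f (u + v) = f u + f v) /\ (forall a u, f (a *: u) = a *: f u).

Lemma submodule_opp L u : submodule L -> L u -> L (- u).
Proof. by case=> _ _ LZ /(LZ (-1)); rewrite scaleN1r. Qed.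

Lemma submodule_sub L u v : submodule L -> L u -> L v -> L (u - v).
Proof.
by move=> sL Lu Lv; case: (sL) => _ LD _; apply: LD => //; apply: submodule_opp.
Qed.

Lemma submodule_addl L u v : submodule L -> L u -> L (u + v) -> L v.
Proof.
by move=> sL Lu Luv; rewrite -[v](addKr u) addrC; apply: submodule_sub sL _ _.
Qed.

Lemma submodule_sum L (I : Type) (r : seq I) (P : pred I) (F : I -> S) :
  submodule L -> (forall i, P i -> L (F i)) -> L (\sum_(i <- r | P i) F i).
Proof. by case=> L0 LD _ LF; apply: big_ind. Qed.

Lemma linear_op0 f : linear_op f -> f 0 = 0.
Proof. by case=> _ fZ; rewrite -[in LHS](scale0r 0) fZ scale0r. Qed.

Lemma linear_opB f u v : linear_op f -> f (u - v) = f u - f v.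
Proof. by case=> fD fZ; rewrite fD -scaleN1r fZ scaleN1r. Qed.

Lemma linear_op_sum f (I : Type) (r : seq I) (P : pred I) (F : I -> S) :
  linear_op f -> f (\sum_(i <- r | P i) F i) = \sum_(i <- r | P i) f (F i).
Proof. by move=> lf; apply: (big_morph f lf.1 (linear_op0 lf)). Qed.

Lemma linear_op_iter f n : linear_op f -> linear_op (iter n f).
Proof.
move=> [fD fZ]; elim: n => [//|n [IHD IHZ]].
by split=> [u v|a u] /=; rewrite ?IHD ?fD ?IHZ ?fZ.
Qed.

Lemma iter_comm f x n u :
  (forall s, f (x s) = x (f s)) -> f (iter n x u) = iter n x (f u).
Proof. by move=> fx; elim: n => //= n <-. Qed.

Lemma submodule_preim f L :
  linear_op f -> submodule L -> submodule [set s | L (f s)].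
Proof.
move=> lf [L0 LD LZ]; case: (lf) => fD fZ; split=> [|u v|a u] /=.
- by rewrite linear_op0.
- by rewrite fD; apply: LD.
- by rewrite fZ; apply: LZ.
Qed.

Lemma saturated_preim f L :
  linear_op f -> saturated L -> saturated [set s | L (f s)].
Proof. by case=> _ fZ sL a u a0 /=; rewrite fZ; apply: sL. Qed.

Lemma satgen_sub G : G `<=` satgen G.
Proof. by move=> s Gs L _ _ GL; apply: GL. Qed.

Lemma satgen_submodule G : submodule (satgen G).
Proof.
split=> [L [] //|u v Gu Gv L sL satL GL|a u Gu L sL satL GL].
  by case: (sL) => _ LD _; apply: LD; [apply: Gu|apply: Gv].
by case: (sL) => _ _ LZ; apply: LZ; apply: Gu.
Qed.

Lemma satgen_saturated G : saturated (satgen G).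
Proof. by move=> a u a0 Gau L sL satL GL; apply: (satL a) => //; apply: Gau. Qed.

Lemma satgen_min G L : submodule L -> saturated L -> G `<=` L -> satgen G `<=` L.
Proof. by move=> sL satL GL s Gs; apply: Gs. Qed.

Lemma sub_sat L : L `<=` sat L.
Proof. by move=> s Ls; exists 1; rewrite ?oner_neq0 ?scale1r. Qed.

Hypothesis hA : ore_domain A.

(** The Ore condition provides a common nonzero multiple of two denominators. *)
Lemma sat_submodule L : submodule L -> submodule (sat L).
Proof.
move=> [L0 LD LZ]; split=> [|u v [a a0 Lu] [b b0 Lv]|c u [a a0 Lu]].
- by exists 1; rewrite ?oner_neq0 ?scaler0.
- have [x [y [x0 xy]]] := hA.2 a b b0.
  exists (x * a); first exact: ore_mulf_neq0.
  by rewrite scalerDr -scalerA xy -scalerA; apply: LD; apply: LZ.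
- have [x [y [x0 xy]]] := hA.2 c a a0.
  by exists x => //; rewrite scalerA xy -scalerA; apply: LZ.
Qed.

Lemma sat_saturated L : saturated (sat L).
Proof.
move=> a u a0 [b b0]; rewrite scalerA => Lu.
by exists (b * a) => //; apply: ore_mulf_neq0.
Qed.

(** Saturating L + span U by [sat] already yields a saturated submodule, so elements of the abstract
    span get explicit coordinates with a denominator. *)
Lemma satgen_finite L U s : submodule L -> satgen (L `|` [set` U]) s ->
  exists a (c : nat -> A), a != 0 /\ L (a *: s - \sum_(i < size U) c i *: U`_i).
Proof.
move=> sL; case: (sL) => L0 LD LZ.
pose W := [set s | exists c : nat -> A, L (s - \sum_(i < size U) c i *: U`_i)].
have sW : submodule W.
  split=> [|u v [c Lu] [c' Lv]|a u [c Lu]].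
  - exists (fun=> 0); rewrite big1 ?subr0 // => i _; exact: scale0r.
  - exists (fun i => c i + c' i); under eq_bigr do rewrite scalerDl.
    by rewrite big_split opprD addrACA; apply: LD.
  - exists (fun i => a * c i); under eq_bigr do rewrite -scalerA.
    by rewrite -scaler_sumr -scalerBr; apply: LZ.
have GW : L `|` [set` U] `<=` W.
  move=> u [Lu|/= uU].
    by exists (fun=> 0); rewrite big1 ?subr0 // => i _; exact: scale0r.
  exists (fun i => (i == index u U)%:R).
  have iU : (index u U < size U)%N by rewrite index_mem.
  rewrite (bigD1 (Ordinal iU)) //= eqxx scale1r nth_index // big1.
    by rewrite addr0 subrr.
  by move=> i /negPf; rewrite -val_eqE /= => ->; rewrite scale0r.
move/(_ (sat W) (sat_submodule sW) (@sat_saturated W)) => [u /GW /sub_sat //|a a0].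
by case=> c; exists a, c.
Qed.

(** Rank bound: the coordinates of size U + 1 elements form a matrix with one row more than columns,
    and a left kernel vector of it is the relation. *)
Lemma satgen_dependent L U (s : nat -> S) :
  submodule L ->
  (forall i, (i <= size U)%N -> satgen (L `|` [set` U]) (s i)) ->
  exists b : nat -> A,
    (exists2 i, (i <= size U)%N & b i != 0) /\
    L (\sum_(i < (size U).+1) b i *: s i).
Proof.
move=> sL sU; set d := size U.
have /choice [ac hac] (i : 'I_d.+1) : exists ac : A * (nat -> A), ac.1 != 0 /\
    L (ac.1 *: s i - \sum_(j < d) ac.2 j *: U`_j).
  by have [a [c [a0 Lac]]] := satgen_finite sL (sU i (ltn_ord i)); exists (a, c).
have [b b0 bC] := ore_left_kernel (\matrix_(i < d.+1, j < d) (ac i).2 j) hA.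
pose bb i := if insub i is Some k then b 0 k * (ac k).1 else 0 : A.
have bbE (i : 'I_d.+1) : bb i = b 0 i * (ac i).1 by rewrite /bb valK.
exists bb; split.
  case/rV0Pn: b0 => i bi; exists i; first exact: (ltn_ord i).
  by rewrite bbE; apply: ore_mulf_neq0 => //; case: (hac i).
have -> : \sum_(i < d.+1) bb i *: s i =
    \sum_i b 0 i *: ((ac i).1 *: s i - \sum_(j < d) (ac i).2 j *: U`_j).
  under [RHS]eq_bigr do rewrite scalerBr scaler_sumr.
  rewrite sumrB exchange_big /= [X in _ - X]big1 ?subr0.
    by apply: eq_bigr => i _; rewrite bbE scalerA.
  move=> j _; under eq_bigr do rewrite scalerA; rewrite -scaler_suml.
  move/rowP: bC => /(_ j); rewrite !mxE => bC.
  suff -> : \sum_i b 0 i * (ac i).2 j = 0 by rewrite scale0r.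
  by rewrite -[RHS]bC; apply: eq_bigr => i _; rewrite mxE.
by case: (sL) => _ _ LZ; apply: submodule_sum => // i _; apply: LZ; case: (hac i).
Qed.

Definition indep L k (w : nat -> S) :=
  forall b : nat -> A, L (\sum_(i < k) b i *: w i) -> forall i, (i < k)%N -> b i = 0.

(** The family [v] alone is independent because [L] is saturated, and the rank bound stops its
    extension. Where it stops, adjoining any [s] creates a relation with nonzero coefficient at
    [s]. *)
Lemma exists_max_indep L U v :
  submodule L -> saturated L -> (forall s, satgen (L `|` [set` U]) s) -> ~ L v ->
  exists k (w : nat -> S), [/\ w 0%N = v, indep L k.+1 w &
    forall s, exists (a : A) (c : nat -> A),
      a != 0 /\ L (a *: s - \sum_(i < k.+1) c i *: w i)].
Proof.
move=> sL satL LU Lv.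
pose Pk k := exists w : nat -> S, w 0%N = v /\ indep L k.+1 w.
have P0 : Pk 0%N.
  exists (fun=> v); split=> // b; rewrite big_ord1 => Lb [|//] _.
  by have [//|b0] := eqVneq (b 0%N) 0; case: Lv; apply: satL Lb.
have Pd : ~ Pk (size U).
  case=> w [_ wind].
  have [b [[i id /eqP bi] Lb]] := satgen_dependent sL (fun i _ => LU (w i)).
  by apply/bi/(wind _ Lb).
have [k [w [w0 wind]] Pk1] : exists2 k, Pk k & ~ Pk k.+1.
  apply: contrapT => H; apply: Pd; elim: (size U) => // m IH.
  by apply: contrapT => Pm; apply: H; exists m.
exists k, w; split=> // s; apply: contrapT => H; apply: Pk1.
exists (fun i => if (i < k.+1)%N then w i else s); split=> // b.
rewrite big_ord_recr /= ltnn; under eq_bigr do rewrite ltn_ord.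
have [bk|bk] := eqVneq (b k.+1) 0.
  rewrite bk scale0r addr0 => /wind bi i; rewrite ltnS leq_eqVlt => /orP [/eqP ->|] //.
  exact: bi.
move=> Lb; case: H; exists (b k.+1), (fun i => - b i); split=> //.
by rewrite -sumrN; under eq_bigr do rewrite scaleNr opprK; rewrite addrC.
Qed.

End Saturation.

(** * The filtration generated by commuting operators *)

Section Filtration.
Variables (A : nzRingType) (hA : ore_domain A) (S : lmodType A).
Implicit Types (f g : S -> S) (s t u : S) (U : seq S).

(** For [L] inside [V], this and [dense_mod] say that the map induced by [g] on V / L is injective,
    respectively has torsion cokernel. *)
Definition inj_mod g (L V : set S) := forall s, V s -> L (g s) -> L s.

Definition dense_mod g (L V : set S) := forall s, V s ->
  exists a t, [/\ a != 0, V t & L (a *: s - g t)].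

Definition rank_le d (L V : set S) := forall s : nat -> S,
  (forall i, (i <= d)%N -> V (s i)) ->
  exists b : nat -> A, (exists2 i, (i <= d)%N & b i != 0) /\
    L (\sum_(i < d.+1) b i *: s i).

Section InjDense.
Variables (g : S -> S) (L V : set S) (d : nat).
Hypotheses (lg : linear_op g) (sL : submodule L) (satL : saturated L).
Hypotheses (sV : submodule V) (gL : forall s, L s -> L (g s)).
Hypotheses (gV : forall s, V s -> V (g s)) (rk : rank_le d L V).

(* A dependency among the iterates [g^i s] can be divided by a power of [g]. *)
Lemma inj_mod_dense : inj_mod g L V -> dense_mod g L V.
Proof.
move=> ginj s Vs; have [LD LZ] : (forall u v, L u -> L v -> L (u + v)) /\
  (forall a u, L u -> L (a *: u)) by case: sL.
have [VD VZ] : (forall u v, V u -> V v -> V (u + v)) /\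
  (forall a u, V u -> V (a *: u)) by case: sV.
have Vg i t : V t -> V (iter i g t) by move=> Vt; elim: i => //= i; apply: gV.
have [b [[j jd bj] Lb]] := rk (fun i _ => Vg i s Vs).
rewrite -(big_mkord xpredT (fun i => b i *: iter i g s)) in Lb.
have {jd bj Lb} : exists k m, b k != 0 /\
    L (iter k g (b k *: s + g (\sum_(0 <= i < m) b (k.+1 + i)%N *: iter i g s))).
  (* With [k] the least index of a nonzero coefficient, [iter k g] factors out of the whole
     relation. *)
  have [k bk mink] := @ex_minnP (fun k => (k <= d)%N && (b k != 0))
    (ex_intro _ j (introT andP (conj jd bj))).
  case/andP: bk => kd bk; exists k, (d - k)%N; split=> //.
  rewrite (@big_cat_nat _ _ _ k) //= in Lb; last exact: leqW.
  rewrite big_nat_cond big1 ?add0r in Lb; last first.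
    move=> i; rewrite andbT => /= ik; have [->|bi] := eqVneq (b i) 0.
      by rewrite scale0r.
    by have := mink i; rewrite bi (leq_trans (ltnW ik) kd) leqNgt ik => /(_ isT).
  rewrite big_ltn ?ltnS // in Lb.
  have lk := linear_op_iter k lg; rewrite lk.1 lk.2 -iterSr.
  rewrite (linear_op_sum _ _ _ (linear_op_iter k.+1 lg)).
  rewrite -{1}[k.+1]add0n big_addn subSS in Lb.
  congr (L (_ + _)): Lb; apply: eq_bigr => i _.
  by rewrite (linear_op_iter k.+1 lg).2 -iterD addnC.
case=> k [m [bk]]; set t := \sum_(0 <= i < m) _ => Lk.
have Vt : V t by apply: submodule_sum => // i _; apply/VZ/Vg.
exists (b k), (- t); split=> //; first exact: submodule_opp.
have -> : g (- t) = - g t by rewrite -scaleN1r lg.2 scaleN1r.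
rewrite opprK; have down l u : L (iter l g u) -> V u -> L u.
  elim: l u => // l IH u Lu Vu.
  by apply: ginj => //; apply: IH; [rewrite -iterSr|apply: gV].
by apply: down Lk _; apply: VD; [apply: VZ|apply: gV].
Qed.

(* Lifting an element of the kernel of [g] repeatedly along [g] would produce
   arbitrarily long independent families. *)
Lemma dense_mod_inj : dense_mod g L V -> inj_mod g L V.
Proof.
move=> gdense s Vs Lgs; apply: contrapT => nLs.
have [LD LZ] : (forall u v, L u -> L v -> L (u + v)) /\
  (forall a u, L u -> L (a *: u)) by case: sL.
have /choice [h hh] (t : S) : exists h : A * S,
    V t -> [/\ h.1 != 0, V h.2 & L (h.1 *: t - g h.2)].
  have [Vt|nVt] := pselect (V t); last by exists (0, 0).
  by have [a [u au]] := gdense t Vt; exists (a, u).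
(* Modulo [L] and up to nonzero scalars, [g] sends [p i.+1] to [p i], and [p 0] is [s]. *)
pose p i := iter i (fun t => (h t).2) s.
have Vp i : V (p i) by elim: i => //= i /hh [].
have gp i : exists2 c, c != 0 & L (c *: s - iter i g (p i)).
  elim: i => [|i [c c0 Lc]].
    by exists 1; rewrite ?oner_neq0 // scale1r subrr; case: sL.
  have [ai Vi Li] := hh _ (Vp i); exists ((h (p i)).1 * c).
    exact: ore_mulf_neq0.
  have [iD iZ] := linear_op_iter i lg.
  have Lgi u : L u -> L (iter i g u) by move=> Lu; elim: i {Lc iD iZ Li ai Vi} => //= i /gL.
  have := LD _ _ (LZ (h (p i)).1 _ Lc) (Lgi _ Li).
  rewrite (linear_opB _ _ (linear_op_iter i lg)) iZ.
  by rewrite scalerBr scalerA addrA subrK -iterSr.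
have pind k : indep L k p.
  (* Since [g s] lies in [L], applying g^k to the relation kills [p i] for i < k. What remains is a
     multiple of [s], which is not in [L], so the last coefficient is 0. *)
  elim: k => // k IH b Lb.
  have bk0 : b k = 0.
    have [//|bk] := eqVneq (b k) 0; case: nLs.
    have [c c0 Lc] := gp k; apply: (satL (a := b k * c)).
      exact: ore_mulf_neq0.
    have Lgk i u : L u -> L (iter i g u) by move=> Lu; elim: i => //= i /gL.
    have := Lgk k _ Lb; rewrite big_ord_recr (linear_op_iter k lg).1 /=.
    rewrite (linear_op_iter k lg).2 linear_op_sum; last exact: linear_op_iter.
    move=> Lsum; have {Lsum}Lbk := submodule_addl sL _ Lsum.
    have -> : (b k * c) *: s = b k *: (c *: s - iter k g (p k)) + b k *: iter k g (p k).
      by rewrite -scalerDr subrK scalerA.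
    apply: (LD); first exact: LZ.
    apply: Lbk; apply: submodule_sum => // i _.
    rewrite (linear_op_iter k lg).2; apply: (LZ).
    have [ci ci0 Lci] := gp i.
    have -> : iter k g (p i) = iter (k - i.+1) g (g (iter i g (p i))).
      by rewrite -iterS -iterD subnK.
    apply: (Lgk).
    have := LD _ _ (gL Lci) (LZ (- ci) _ Lgs).
    rewrite linear_opB // lg.2 scaleNr addrAC subrr add0r => /(submodule_opp sL).
    by rewrite opprK.
  move=> i; rewrite ltnS leq_eqVlt => /orP [/eqP -> //|]; apply: IH.
  by move: Lb; rewrite big_ord_recr /= bk0 scale0r addr0.
have [b [[i id /eqP bi] Lb]] := rk (fun i _ => Vp i).
by apply: bi; apply: pind Lb _ _.
Qed.

End InjDense.

(* The multiplication by [G_k] and by [g_k = 1 + G_k], where [G_0 = x] and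
   [G_{k+1} = G_k * g_k]: as in Euclid's proof of the infinity of primes, the
   [g_k] are pairwise comaximal central polynomials in [x]. *)
Fixpoint euclid_op (x : S -> S) k s : S :=
  if k is k'.+1 then euclid_op x k' s + euclid_op x k' (euclid_op x k' s) else x s.

Definition euclid_op1 x k s := s + euclid_op x k s.

Lemma linear_euclid_op x k : linear_op x -> linear_op (euclid_op x k).
Proof.
move=> lx; elim: k => //= k [GD GZ].
by split=> [u v|a u]; rewrite ?GD ?GZ ?GD ?GZ ?scalerDr // addrACA.
Qed.

Lemma linear_euclid_op1 x k : linear_op x -> linear_op (euclid_op1 x k).
Proof.
move=> /(linear_euclid_op k) [GD GZ]; rewrite /euclid_op1.
by split=> [u v|a u]; rewrite ?GD ?GZ ?scalerDr // addrACA.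
Qed.

Lemma euclid_op_comm f x k s : linear_op f ->
  (forall s, f (x s) = x (f s)) -> f (euclid_op x k s) = euclid_op x k (f s).
Proof. by move=> lf fx; elim: k s => //= k IH s; rewrite lf.1 !IH. Qed.

Lemma euclid_op1_comm f x k s : linear_op f ->
  (forall s, f (x s) = x (f s)) -> f (euclid_op1 x k s) = euclid_op1 x k (f s).
Proof. by move=> lf fx; rewrite /euclid_op1 lf.1 euclid_op_comm. Qed.

Lemma euclid_op_stable x k (L : set S) :
  submodule L -> (forall s, L s -> L (x s)) ->
  forall s, L s -> L (euclid_op x k s).
Proof.
move=> [L0 LD LZ] xL; elim: k => //= k IH s Ls.
by apply: LD; [apply: IH|apply: (IH); apply: IH].
Qed.

Lemma euclid_op1_stable x k (L : set S) :
  submodule L -> (forall s, L s -> L (x s)) ->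
  forall s, L s -> L (euclid_op1 x k s).
Proof.
move=> sL xL s Ls; case: (sL) => _ LD _; apply: LD => //.
exact: euclid_op_stable.
Qed.

(** If every g_k had a kernel on V / L, comaximality would make the chosen kernel elements an
    infinite independent family, against the finite rank. *)
Lemma exists_euclid_inj x L V d :
  linear_op x -> submodule L -> saturated L -> (forall s, L s -> L (x s)) ->
  rank_le d L V -> exists k, inj_mod (euclid_op1 x k) L V.
Proof.
move=> lx sL satL xL rk; apply: contrapT => /forallNP noinj.
have /choice [s hs] k : exists s, [/\ V s, L (euclid_op1 x k s) & ~ L s].
  apply: contrapT => H; apply: (noinj k) => s Vs Ls; apply: contrapT => nLs.
  by apply: H; exists s.
have [LD LZ] : (forall u v, L u -> L v -> L (u + v)) /\
  (forall a u, L u -> L (a *: u)) by case: sL.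
(* For i < k, g_i divides G_{i+1}, which divides G_k. *)
have kill i k : (i < k)%N -> L (euclid_op x k (s i)).
  elim: k => // k IH; rewrite ltnS leq_eqVlt => /orP [/eqP <-|/IH Lk] /=; last first.
    by apply: LD => //; apply: euclid_op_stable.
  rewrite -(linear_euclid_op i lx).1; apply: euclid_op_stable => //.
  by case: (hs i).
have sind k : indep L k s.
  elim: k => // k IH b Lb.
  (* G_k kills every term but the last. As g_k = 1 + G_k also kills [s k], the term [b k *: s k]
     itself lies in [L]. *)
  have Lbk : L (b k *: euclid_op x k (s k)).
    have := euclid_op_stable k sL xL Lb.
    have lk := linear_euclid_op k lx.
    rewrite big_ord_recr lk.1 /= lk.2 linear_op_sum //.
    apply: submodule_addl => //; apply: submodule_sum => // i _.
    by rewrite lk.2; apply/LZ/kill.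
  have [_ Lk nLk] := hs k; have {}Lk := LZ (b k) _ Lk.
  have bk0 : b k = 0.
    have [//|bk] := eqVneq (b k) 0; case: nLk; apply: satL bk _.
    by move: Lk; rewrite scalerDr addrC; apply: submodule_addl.
  move=> i; rewrite ltnS leq_eqVlt => /orP [/eqP -> //|]; apply: IH.
  by move: Lb; rewrite big_ord_recr /= bk0 scale0r addr0.
have [b [[i id /eqP bi] Lb]] : exists b : nat -> A,
    (exists2 i, (i <= d)%N & b i != 0) /\ L (\sum_(i < d.+1) b i *: s i).
  by apply: rk => i _; case: (hs i).
by apply: bi; apply: sind Lb _ _.
Qed.

Section Chain.
Variables (n : nat) (X : nat -> S -> S) (L0 : set S).
Hypothesis lX : forall i, (i < n)%N -> linear_op (X i).

(** Saturating at each step keeps the successive quotients torsion-free, which the passage from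
    density to injectivity requires. *)
Fixpoint chain m : set S :=
  if m is m'.+1 then
    satgen (chain m' `|` [set t | exists i s, [/\ (i < n)%N, chain m' s & t = X i s]])
  else L0.

Lemma chainS m : chain m `<=` chain m.+1.
Proof. by move=> s Ls; apply: satgen_sub; left. Qed.

Lemma chain_op m i s : (i < n)%N -> chain m s -> chain m.+1 (X i s).
Proof. by move=> ltin Ls; apply: satgen_sub; right; exists i, s. Qed.

Lemma chain_min m W : submodule W -> saturated W -> chain m `<=` W ->
  (forall i s, (i < n)%N -> chain m s -> W (X i s)) -> chain m.+1 `<=` W.
Proof.
move=> sW satW LW XW; apply: satgen_min => // t [/LW //|[i [s [ltin Ls ->]]]].
exact: XW.
Qed.

Hypotheses (sL0 : submodule L0) (satL0 : saturated L0).

Lemma chain_submodule m : submodule (chain m).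
Proof. by case: m => // m; apply: satgen_submodule. Qed.

Lemma chain_saturated m : saturated (chain m).
Proof. by case: m => // m; apply: satgen_saturated. Qed.

Lemma chain_stable f m : linear_op f ->
  (forall i s, (i < n)%N -> X i (f s) = f (X i s)) ->
  (forall s, L0 s -> L0 (f s)) -> forall s, chain m s -> chain m (f s).
Proof.
move=> lf Xf fL0; elim: m => // m IH; apply: chain_min.
- by apply: submodule_preim => //; apply: (chain_submodule m.+1).
- by apply: saturated_preim => //; apply: (chain_saturated (m := m.+1)).
- by move=> s /IH /chainS.
- by move=> i s ltin Ls /=; rewrite -Xf //; apply: chain_op => //; apply: IH.
Qed.

(** If [Um] generates one quotient of the filtration up to torsion, its images under the [X i]
    generate the next. *)
Lemma chain_finite U m :
  (forall i s, (i < n)%N -> L0 s -> satgen (L0 `|` [set` U]) (X i s)) ->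
  exists Um : seq S, chain m.+1 `<=` satgen (chain m `|` [set` Um]).
Proof.
move=> XU; elim: m => [|m [Um hUm]].
  exists U; apply: chain_min => //; first exact: satgen_submodule.
    exact: satgen_saturated.
  by move=> s Ls; apply: satgen_sub; left.
exists [seq X i u | i <- iota 0 n, u <- Um].
set W := satgen _; have sW : submodule W by apply: satgen_submodule.
have satW : saturated W by apply: satgen_saturated.
apply: chain_min => // [s Ls|i s ltin Ls]; first by apply: satgen_sub; left.
move: s {Ls} (hUm s Ls); apply: satgen_min.
- by apply: submodule_preim => //; apply: lX.
- by apply: saturated_preim => //; apply: lX.
move=> s [Ls|/= sU]; apply: satgen_sub; first by left; apply: chain_op.
by right; apply/allpairsP; exists (i, s); rewrite mem_iota.
Qed.

(** One [k], chosen for the first quotient, serves all [m]. Injectivity is not inherited by images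
    under the [X i], but density is, and finite rank converts each into the other. *)
Lemma euclid_op1_inj_chain x U : linear_op x ->
  (forall i s, (i < n)%N -> X i (x s) = x (X i s)) ->
  (forall s, L0 s -> L0 (x s)) ->
  (forall i s, (i < n)%N -> L0 s -> satgen (L0 `|` [set` U]) (X i s)) ->
  exists k, forall m s, chain m s -> L0 (euclid_op1 x k s) -> L0 s.
Proof.
move=> lx Xx xL0 XU.
have rk m : exists d, rank_le d (chain m) (chain m.+1).
  have [Um hUm] := chain_finite m XU; exists (size Um) => s Ls.
  apply: satgen_dependent => //; first exact: chain_submodule.
  by move=> i id; apply: hUm; apply: Ls.
have [d0 rk0] := rk 0%N.
have [k injk] := exists_euclid_inj lx sL0 satL0 xL0 rk0; exists k.
have lg := linear_euclid_op1 k lx; set g := euclid_op1 x k in lg injk *.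
have gL m s : chain m s -> chain m (g s).
  apply: chain_stable => // [i t ltin|t]; last exact: euclid_op1_stable.
  by apply: euclid_op1_comm; [apply: lX|move=> u; apply: Xx].
have densem m : dense_mod g (chain m) (chain m.+1).
  elim: m => [|m IH].
    apply: (inj_mod_dense (d := d0)) => //; [exact: chain_submodule|exact: (gL 1%N)].
  (* Density on the next quotient amounts to [chain m.+2] lying in [W]; by minimality of the chain
     it suffices to test images under the [X i]. *)
  pose W := sat [set s | exists2 t, chain m.+2 t & chain m.+1 (s - g t)].
  have [sm2 sm1] := (chain_submodule m.+2, chain_submodule m.+1).
  have sW : submodule W.
    apply: sat_submodule => //; case: sm2 sm1 => [M0 MD MZ] [N0 ND NZ].
    split=> [|u v [t Mt Nt] [t' Mt' Nt']|a u [t Mt Nt]].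
    - by exists 0; rewrite // linear_op0 // subr0.
    - by exists (t + t'); [apply: MD|rewrite lg.1 opprD addrACA; apply: ND].
    - by exists (a *: t); [apply: MZ|rewrite lg.2 -scalerBr; apply: NZ].
  suff MW : chain m.+2 `<=` W.
    by move=> s /MW [a a0 [t Mt Nt]]; exists a, t.
  apply: chain_min => //; first exact: sat_saturated.
    move=> s Ls; apply: sub_sat; exists 0; first by case: sm2.
    by rewrite linear_op0 // subr0.
  move=> i s ltin /IH [a [t [a0 Mt Nt]]]; exists a => //.
  exists (X i t); first exact: chain_op.
  have lXi := lX ltin.
  have -> : g (X i t) = X i (g t).
    by rewrite /g euclid_op1_comm // => u; apply: Xx.
  rewrite -lXi.2 -linear_opB //.
  exact: chain_op.
(* Injectivity on each quotient lowers [s] one level at a time, down to [L0]. *)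
elim=> [//|m IH] s Ms L0s; apply: IH => //.
have [d rkm] := rk m.
apply: (dense_mod_inj (d := d) (g := g) (V := chain m.+1)) => //.
- exact: chain_submodule.
- exact: chain_saturated.
- exact: gL.
- by elim: m {Ms rkm} => // m; apply: chainS.
Qed.

End Chain.
End Filtration.

(** * Modules over a polynomial ring *)

Section PolyAction.
Variables (A : nzRingType) (S : lmodType A) (x : S -> S).
Implicit Types (p q : {poly A}) (s : S).

Definition poly_act p s := \sum_(i < size p) p`_i *: iter i x s.

Lemma poly_actE m p s : (size p <= m)%N ->
  poly_act p s = \sum_(i < m) p`_i *: iter i x s.
Proof.
move=> pm; rewrite /poly_act -(big_mkord xpredT (fun i => p`_i *: iter i x s)).
rewrite -(big_mkord xpredT (fun i => p`_i *: iter i x s)).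
rewrite [RHS](@big_cat_nat _ _ _ (size p)) //= [X in _ + X]big_nat_cond.
rewrite [X in _ + X]big1 ?addr0 // => i; rewrite andbT => /andP [pi _].
by rewrite nth_default // scale0r.
Qed.

Lemma poly_actD p q s : poly_act (p + q) s = poly_act p s + poly_act q s.
Proof.
pose m := maxn (size p) (size q).
rewrite (poly_actE s (size_polyD p q)) (@poly_actE m p) ?leq_maxl //.
rewrite (@poly_actE m q) ?leq_maxr // -big_split /=.
by apply: eq_bigr => i _; rewrite coefD scalerDl.
Qed.

Lemma poly_actCM a p s : poly_act (a%:P * p) s = a *: poly_act p s.
Proof.
rewrite (@poly_actE (size p) (a%:P * p)) ?mul_polyC ?size_scale_leq //.
by rewrite scaler_sumr; apply: eq_bigr => i _; rewrite coefZ scalerA.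
Qed.

Lemma poly_actC a s : poly_act a%:P s = a *: s.
Proof. by rewrite (poly_actE s (size_polyC_leq1 a)) big_ord1 coefC. Qed.

Lemma poly_actMX p s : poly_act (p * 'X) s = poly_act p (x s).
Proof.
rewrite (@poly_actE (size p).+1); last first.
  by apply: leq_trans (size_polyMleq _ _) _; rewrite size_polyX addnC.
rewrite big_ord_recl coefMX scale0r add0r; apply: eq_bigr => i _.
by rewrite coefMX /= -iterSr.
Qed.

Hypothesis lx : linear_op x.

Lemma poly_act_add p s t : poly_act p (s + t) = poly_act p s + poly_act p t.
Proof.
rewrite -big_split; apply: eq_bigr => i _ /=.
by rewrite (linear_op_iter i lx).1 scalerDr.
Qed.

Lemma poly_act_comm (f : S -> S) p s : linear_op f ->
  (forall s, f (x s) = x (f s)) -> f (poly_act p s) = poly_act p (f s).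
Proof.
move=> lf fx; rewrite linear_op_sum //; apply: eq_bigr => i _.
by rewrite lf.2 iter_comm.
Qed.

Lemma poly_actM p q s : poly_act (p * q) s = poly_act p (poly_act q s).
Proof.
elim/poly_ind: p s => [|p c IH] s.
  by rewrite mul0r -polyC0 !poly_actC !scale0r.
rewrite mulrDl -mulrA -commr_polyX !poly_actD mulrA poly_actMX poly_actMX IH.
by rewrite poly_actCM poly_actC (poly_act_comm (f := x)).
Qed.

Lemma poly_act_stable (L : set S) p : submodule L -> (forall s, L s -> L (x s)) ->
  forall s, L s -> L (poly_act p s).
Proof.
move=> sL xL s Ls; apply: submodule_sum => // i _; case: sL => _ _; apply.
by elim: (i : nat) => //= k; apply: xL.
Qed.

End PolyAction.

(* [S] as a module over [A[X]], where [X] acts through [x]. *)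
Definition polymod (A : nzRingType) (S : lmodType A) (x : S -> S)
  (lx : linear_op x) : Type := S.

Section PolyModule.
Variables (A : nzRingType) (S : lmodType A) (x : S -> S) (lx : linear_op x).

HB.instance Definition _ := GRing.Zmodule.copy (polymod lx) S.

Fact polymod_scalerA (p q : {poly A}) (s : polymod lx) :
  poly_act x p (poly_act x q s) = poly_act x (p * q) s.
Proof. by rewrite poly_actM. Qed.

Fact polymod_scale1r (s : polymod lx) : poly_act x 1 s = s.
Proof. by rewrite -polyC1 poly_actC scale1r. Qed.

Fact polymod_scalerDr (p : {poly A}) (s t : polymod lx) :
  poly_act x p (s + t) = poly_act x p s + poly_act x p t.
Proof. exact: poly_act_add. Qed.

Fact polymod_scalerDl (s : polymod lx) (p q : {poly A}) :
  poly_act x (p + q) s = poly_act x p s + poly_act x q s.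
Proof. exact: poly_actD. Qed.

HB.instance Definition _ := @GRing.Zmodule_isLmodule.Build {poly A} (polymod lx)
  (poly_act x : {poly A} -> polymod lx -> polymod lx)
  polymod_scalerA polymod_scale1r polymod_scalerDr polymod_scalerDl.

Lemma polymod_scaleE (p : {poly A}) (s : polymod lx) : p *: s = poly_act x p s.
Proof. by []. Qed.

Lemma submodule_polymod (L : set S) :
  @submodule _ (polymod lx) L <-> submodule L /\ (forall s, L s -> L (x s)).
Proof.
split=> [[L0 LD LZ]|[sL xL]]; last first.
  case: (sL) => L0 LD LZ; split=> // p u Lu.
  by rewrite polymod_scaleE; apply: poly_act_stable.
split=> [|s /(LZ 'X)].
  by split=> // a u /(LZ a%:P); rewrite polymod_scaleE poly_actC.
by rewrite polymod_scaleE -['X]mul1r poly_actMX -polyC1 poly_actC scale1r.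
Qed.

Lemma linear_op_polymod (f : S -> S) : linear_op f ->
  (forall s, f (x s) = x (f s)) -> @linear_op _ (polymod lx) f.
Proof.
by move=> lf fx; split=> [|p u]; [exact: lf.1|rewrite !polymod_scaleE poly_act_comm].
Qed.

End PolyModule.

Fixpoint euclid_poly (A : nzRingType) k : {poly A} :=
  if k is k'.+1 then euclid_poly A k' + euclid_poly A k' * euclid_poly A k' else 'X.

Lemma euclid_poly_act (A : nzRingType) (S : lmodType A) (x : S -> S) k s :
  linear_op x -> poly_act x (1 + euclid_poly A k) s = euclid_op1 x k s.
Proof.
move=> lx; rewrite poly_actD -polyC1 poly_actC scale1r; congr (_ + _).
elim: k s => [|k IH] s /=; last by rewrite poly_actD poly_actM // !IH.
by rewrite -['X]mul1r poly_actMX -polyC1 poly_actC scale1r.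
Qed.

(** Prepares the final degree count: a product with a monic factor of positive degree is never a
    nonzero constant. *)
Lemma euclid_poly_monic (A : nzRingType) k :
  [/\ euclid_poly A k \is monic, 1 + euclid_poly A k \is monic &
      (1 < size (1 + euclid_poly A k)%R)%N].
Proof.
have aux (p : {poly A}) : p \is monic -> (1 < size p)%N ->
    1 + p \is monic /\ size (1 + p) = size p.
  by move=> pm ps; rewrite monicE addrC lead_coefDl ?size_polyDl ?size_poly1.
have [pm ps] : euclid_poly A k \is monic /\ (1 < size (euclid_poly A k))%N.
  elim: k => [|k [pm ps]] /=; first by rewrite monicX size_polyX.
  set p := euclid_poly A k in pm ps *; have [qm qs] := aux p pm ps.
  have -> : p + p * p = p * (1 + p) by rewrite mulrDr mulr1.
  split; first by rewrite monicMl.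
  rewrite size_monicM ?monic_neq0 // qs; case: (size p) ps => [|[|m]] // _.
  by rewrite addnS.
by have [qm qs] := aux _ pm ps; rewrite qs.
Qed.

(** * Algebraic operators *)

Section Algebraic.
Variables (A : nzRingType) (S : lmodType A) (N : set S).
Implicit Types (x : S -> S) (U : seq S).

Definition algebraic_at x v := exists2 p : {poly A}, p != 0 & N (poly_act x p v).

(** The leading coefficient of the recurrence need not be a unit; saturation of [W] divides by
    it. *)
Lemma recurrence_closed (W : set S) (p : {poly A}) (f : nat -> S) :
  submodule W -> saturated W -> p != 0 ->
  (forall e, W (\sum_(l < size p) p`_l *: f (e + l)%N)) ->
  (forall e, (e < (size p).-1)%N -> W (f e)) -> forall e, W (f e).
Proof.
move=> sW satW p0 Wp Wf; elim/ltn_ind => e IH.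
have [/Wf //|pe] := ltnP e (size p).-1; have := Wp (e - (size p).-1)%N.
have sp : size p = (size p).-1.+1 by rewrite prednK // size_poly_gt0.
rewrite sp big_ord_recr /= subnK // => Wsum; apply: (satW (lead_coef p)).
  by rewrite lead_coef_eq0.
apply: submodule_addl Wsum => //; apply: submodule_sum => // i _.
case: (sW) => _ _; apply; apply: IH.
by rewrite -[X in (_ < X)%N](subnK pe) ltn_add2l.
Qed.

Lemma algebraic_iter_closed x u p W :
  linear_op x -> submodule N -> (forall s, N s -> N (x s)) ->
  submodule W -> saturated W -> N `<=` W -> p != 0 -> N (poly_act x p u) ->
  (forall e, (e < (size p).-1)%N -> W (iter e x u)) -> forall e, W (iter e x u).
Proof.
move=> lx sN xN sW satW NW p0 Npu; apply: recurrence_closed p0 _ => // e.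
have -> : \sum_(l < size p) p`_l *: iter (e + l) x u = iter e x (poly_act x p u).
  have le := linear_op_iter e lx.
  by rewrite linear_op_sum //; apply: eq_bigr => l _; rewrite le.2 iterD.
by apply: NW; elim: e => //= e; apply: xN.
Qed.

(** The operators are adjoined one at a time: each generator [u] is replaced by the [iter e x u]
    with [e] below the degree of a polynomial killing [u] modulo [N]. Stability under the earlier
    operators survives because they commute with [x]. *)
Lemma algebraic_finite n (X : nat -> S -> S) v :
  submodule N ->
  (forall i, (i < n)%N -> linear_op (X i)) ->
  (forall i j s, (i < n)%N -> (j < n)%N -> X i (X j s) = X j (X i s)) ->
  (forall i s, (i < n)%N -> N s -> N (X i s)) ->
  (forall i s, (i < n)%N -> algebraic_at (X i) s) ->
  exists U, satgen (N `|` [set` U]) v /\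
    forall i s, (i < n)%N -> satgen (N `|` [set` U]) s -> satgen (N `|` [set` U]) (X i s).
Proof.
move=> sN lX XX XN Xalg.
suff: forall m, (m <= n)%N -> exists U, satgen (N `|` [set` U]) v /\
    forall i s, (i < m)%N ->
      satgen (N `|` [set` U]) s -> satgen (N `|` [set` U]) (X i s) by exact.
elim=> [|m IH] ltmn.
  by exists [:: v]; split=> //; apply: satgen_sub; right; rewrite /= inE.
have [U [Uv UX]] := IH (ltnW ltmn); set x := X m; have lx : linear_op x := lX _ ltmn.
have /choice [P hP] (u : S) : exists p, p != 0 /\ N (poly_act x p u).
  by have [p] := Xalg _ u ltmn; exists p.
exists [seq iter e x u | u <- U, e <- iota 0 (size (P u)).-1].
set W := satgen (_ `|` [set` [seq _ | _ <- U, _ <- _]]).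
have sW : submodule W by apply: satgen_submodule.
have satW : saturated W by apply: satgen_saturated.
have NW : N `<=` W by move=> s Ns; apply: satgen_sub; left.
have Wu u e : u \in U -> W (iter e x u).
  move=> uU; have [p0 Np] := hP u; move: e.
  apply: (algebraic_iter_closed lx sN _ sW satW NW p0 Np) => [s|e ep].
    exact: XN.
  apply: satgen_sub; right; apply/allpairsPdep; exists u, e.
  by rewrite mem_iota.
have UW e : satgen (N `|` [set` U]) `<=` [set s | W (iter e x s)].
  have le := linear_op_iter e lx.
  apply: satgen_min; [exact: submodule_preim|exact: saturated_preim|].
  move=> s [Ns|/= sU]; last exact: Wu.
  by apply: NW; elim: e {le} => //= e; apply: XN.
split=> [|i s ltim]; first exact: (UW 0%N).
have ltin : (i < n)%N by apply: leq_trans ltmn.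
have lXi := lX i ltin; move: s; apply: satgen_min.
- exact: submodule_preim.
- exact: saturated_preim.
move=> s [Ns|/= /allpairsPdep [u [e [uU _ ->]]]]; first by apply: NW; apply: XN.
move: ltim; rewrite ltnS leq_eqVlt => /orP [/eqP ->|ltim]; first exact: (Wu u e.+1).
rewrite iter_comm; last by move=> t; apply: XX.
by apply: UW; apply: UX => //; apply: satgen_sub; right.
Qed.

End Algebraic.

(* Simplicity of [S / N] under the operators [X 0, ..., X (n - 1)], up to
   [A]-torsion. *)
Definition essentially_simple (A : nzRingType) (S : lmodType A) (N : set S)
    n (X : nat -> S -> S) :=
  forall W : set S, submodule W -> N `<=` W ->
    (forall i s, (i < n)%N -> W s -> W (X i s)) -> (exists2 w, W w & ~ N w) ->
    forall s, sat W s.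

(** * The Amitsur-Small theorem *)

(** The ring [A] is quantified inside because the induction on [n] trades one operator for the
    passage from [A] to [{poly A}]. *)
Definition finitely_generated_if_simple n :=
  forall (A : nzRingType) (S : lmodType A) (N : set S) (X : nat -> S -> S),
  ore_domain A -> submodule N ->
  (forall i, (i < n)%N -> linear_op (X i)) ->
  (forall i j s, (i < n)%N -> (j < n)%N -> X i (X j s) = X j (X i s)) ->
  (forall i s, (i < n)%N -> N s -> N (X i s)) ->
  essentially_simple N n X ->
  exists U : seq S, forall s, satgen (N `|` [set` U]) s.

Lemma chain_mono (A : nzRingType) (S : lmodType A) n (X : nat -> S -> S) L0 m m' :
  (m <= m')%N -> chain n X L0 m `<=` chain n X L0 m'.
Proof.
by move=> /subnK <-; elim: (m' - m)%N => // k IH s /IH; apply: chainS.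
Qed.

(** * Excluding a transcendental operator *)

Section TranscendentalOperator.
Variables (n : nat) (A : nzRingType) (S : lmodType A) (N : set S).
Variables (X : nat -> S -> S) (i0 : nat) (v : S).
Hypotheses (IH : finitely_generated_if_simple n) (hA : ore_domain A).
Hypothesis sN : submodule N.
Hypothesis lX : forall i, (i < n.+1)%N -> linear_op (X i).
Hypothesis XX : forall i j s, (i < n.+1)%N -> (j < n.+1)%N ->
  X i (X j s) = X j (X i s).
Hypothesis XN : forall i s, (i < n.+1)%N -> N s -> N (X i s).
Hypothesis simpleN : essentially_simple N n.+1 X.
Hypotheses (lti0 : (i0 < n.+1)%N) (trv : ~ algebraic_at N (X i0) v).

Let x := X i0.
Let lx : linear_op x := lX lti0.
Let T := polymod lx.
Let hT : ore_domain {poly A} := ore_domain_poly hA.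
Let Y j := X (bump i0 j).
Let NT : set T := N.

Let bump_lt j : (j < n)%N -> (bump i0 j < n.+1)%N.
Proof. by rewrite /bump => ltjn; case: (i0 <= j)%N; rewrite ?add0n ?ltnS // ltnW. Qed.

Let unbump_lt i : (i < n.+1)%N -> i != i0 -> (unbump i0 i < n)%N.
Proof.
rewrite /unbump neq_ltn => lti /orP [ii0|ii0].
  by rewrite [(i0 < i)%N]ltnNge (ltnW ii0) subn0 (leq_trans ii0).
by rewrite ii0 subn1 -ltnS prednK // (leq_ltn_trans _ ii0).
Qed.

Let sNT : submodule NT.
Proof. by apply/submodule_polymod; split=> // s; apply: XN. Qed.

Let vN : ~ N v.
Proof.
move=> Nv; apply: trv; exists 1; rewrite ?oner_neq0 //.
by rewrite -polyC1 poly_actC scale1r.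
Qed.

(** The [{poly A}]-torsion modulo [N] is stable under all operators. Were it larger than [N],
    simplicity would put a nonzero multiple of [v] in it, making [x] algebraic at [v]. *)
Let satNT : saturated NT.
Proof.
move=> p u p0 Npu; apply: contrapT => nNu.
have /submodule_polymod [sW xW] := sat_submodule hT sNT.
have [||a a0 [q q0]] := simpleN sW (@sub_sat _ T NT) _ _ v.
- move=> i s lti [q q0 Nq]; exists q => //.
  rewrite polymod_scaleE -poly_act_comm; [exact: XN|exact: lX|].
  by move=> t; apply: XX.
- by exists u => //; exists p.
rewrite polymod_scaleE -(poly_actC x) -poly_actM //; apply: contra_not trv => Nqa.
by exists (q * a%:P) => //; apply: ore_mulf_neq0; rewrite ?polyC_eq0.
Qed.

Let Y_linear j : (j < n)%N -> linear_op (Y j).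
Proof. by move=> /bump_lt; apply: lX. Qed.

Let Y_comm j s : (j < n)%N -> Y j (x s) = x (Y j s).
Proof. by move=> /bump_lt ltj; apply: XX. Qed.

(** Simplicity passes to the [n] operators [Y] over [{poly A}], so the induction hypothesis gives
    finite rank there, and [v] extends to a maximal independent family. *)
Let exists_basis : exists k (w : nat -> T), [/\ w 0%N = v, indep NT k.+1 w &
  forall s, exists (p : {poly A}) (c : nat -> {poly A}),
    p != 0 /\ NT (p *: s - \sum_(i < k.+1) c i *: w i)].
Proof.
have [U NU] : exists U : seq T, forall s, satgen (NT `|` [set` U]) s.
  apply: (@IH _ T NT Y) => //.
  - by move=> j ltj; exact: (linear_op_polymod lx (Y_linear ltj) (fun s => Y_comm s ltj)).
  - by move=> i j s lti ltj; apply: XX; apply: bump_lt.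
  - by move=> j s ltj; apply: XN; apply: bump_lt.
  move=> W /submodule_polymod [sW xW] NW YW nNW s.
  have [i t lti Wt|a a0 Was] := simpleN sW NW _ nNW s.
    have [->|ii0] := eqVneq i i0; first exact: xW.
    by have := YW _ _ (unbump_lt lti ii0) Wt; rewrite /Y unbumpK.
  by exists a%:P; rewrite ?polyC_eq0 // polymod_scaleE poly_actC.
exact: exists_max_indep NU vN.
Qed.

Lemma transcendental_absurd : False.
Proof.
have [k [w [w0 wind wspan]]] := exists_basis.
pose F : set T := [set s | exists c : nat -> {poly A},
  NT (s - \sum_(i < k.+1) c i *: w i)].
have NF : NT `<=` F.
  by move=> s Ns; exists (fun=> 0); rewrite big1 ?subr0 // => i _; apply: scale0r.
have FT : submodule F.
  case: sNT => N0 ND NZ; split=> [|s t [c Ns] [c' Nt]|p s [c Ns]].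
  - exact: NF.
  - exists (fun i => c i + c' i); under eq_bigr do rewrite scalerDl.
    by rewrite big_split opprD addrACA; apply: ND.
  - exists (fun i => p * c i); under eq_bigr do rewrite -scalerA.
    by rewrite -scaler_sumr -scalerBr; apply: NZ.
have Fw j : (j < k.+1)%N -> F (w j).
  move=> ltj; exists (fun i => (i == j)%:R).
  rewrite (bigD1 (Ordinal ltj)) //= eqxx scale1r big1 ?addr0 ?subrr.
    by case: sNT.
  by move=> i /negPf; rewrite -val_eqE /= => ->; rewrite scale0r.
have /submodule_polymod [sF xF] := FT.
(* The saturation is over [A] only: over [{poly A}] it would be all of [S], by [wspan]. *)
pose L0 : set S := @sat A S F.
have sL0 : submodule L0 by apply: sat_submodule.
have satL0 : saturated L0 by apply: sat_saturated.
have FL0 : F `<=` L0 := @sub_sat A S F.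
have xL0 s : L0 s -> L0 (x s).
  by case=> a a0 Fs; exists a => //; rewrite -lx.2; apply: xF.
(* The recurrence given by [P (l, j)] reduces the powers of [x] on [Y l (w j)] to finitely many
   modulo [L0], so the first quotient of the filtration is finitely generated over [A]. *)
have /choice [P hP] (lj : nat * nat) :
    exists p, p != 0 /\ L0 (poly_act x p (Y lj.1 (w lj.2))).
  have [p [c [p0 Np]]] := wspan (Y lj.1 (w lj.2)); exists p; split=> //.
  by apply: FL0; exists c.
pose I := [seq (l, j) | l <- iota 0 n, j <- iota 0 k.+1].
pose U : seq S := [seq iter e x (Y lj.1 (w lj.2)) | lj <- I,
  e <- iota 0 (size (P lj)).-1].
have YU l s : (l < n)%N -> L0 s -> satgen (L0 `|` [set` U]) (Y l s).
  move=> ltl; set W := satgen _.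
  have sW : submodule W by apply: satgen_submodule.
  have satW : saturated W by apply: satgen_saturated.
  have LW : L0 `<=` W by move=> t Lt; apply: satgen_sub; left.
  have lY := Y_linear ltl.
  have Ww j e : (j < k.+1)%N -> W (iter e x (Y l (w j))).
    move=> ltj; have [p0 Lp] := hP (l, j); move: e.
    apply: (algebraic_iter_closed lx sL0 xL0 sW satW LW p0 Lp) => e ep.
    apply: satgen_sub; right; apply/allpairsPdep; exists (l, j), e.
    by rewrite allpairs_f ?mem_iota.
  case=> a a0 [c Ns]; apply: (satW a) => //; rewrite -lY.2.
  pose z : S := \sum_(j < k.+1) poly_act x (c j) (w j).
  have Wz : W (Y l z).
    rewrite linear_op_sum //; apply: submodule_sum => // j _.
    rewrite poly_act_comm //; last by move=> t; apply: Y_comm.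
    by apply: submodule_sum => // e _; case: (sW) => _ _; apply; apply: Ww.
  have Wd : W (Y l (a *: s - z)).
    apply: (LW _ (FL0 _ (NF _ _))); apply: XN; [exact: bump_lt|exact: Ns].
  rewrite -[a *: s](subrK z) lY.1; case: (sW) => _ WD _; exact: WD.
have [k0 injL] := euclid_op1_inj_chain hA Y_linear sL0 satL0 lx
  (fun i s lti => Y_comm s lti) xL0 YU.
set g := euclid_op1 x k0 in injL.
have lg : linear_op g by apply: linear_euclid_op1.
have [_ qm qs] := euclid_poly_monic A k0; set q := 1 + _ in qm qs.
have gE s : g s = q *: (s : T) by rewrite polymod_scaleE euclid_poly_act.
have Fv : F v by rewrite -w0; apply: Fw.
(* The union of the filtration is stable under all operators and contains [v], so simplicity makes
   it everything up to torsion; saturation removes the torsion. *)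
have chainS' s : exists m, chain n Y L0 m s.
  have sC m := chain_submodule n Y sL0 m.
  have [||||a a0 [m Cm]] := simpleN (W := [set s | exists m, chain n Y L0 m s]) _ _ _ _ s.
  - split=> [|t u [m Ct] [m' Cu]|a t [m Ct]].
    + by exists 0%N; case: sL0.
    + exists (maxn m m'); case: (sC (maxn m m')) => _ CD _.
      by apply: CD; [apply: chain_mono Ct; rewrite leq_maxl|
                     apply: chain_mono Cu; rewrite leq_maxr].
    + by exists m; case: (sC m) => _ _; apply.
  - by move=> t Nt; exists 0%N; apply: (FL0 _ (NF _ _)).
  - move=> i t lti [m Ct]; have [->|ii0] := eqVneq i i0.
      exists m; exact: (chain_stable sL0 satL0 lx
        (fun j u ltj => Y_comm u ltj) xL0 Ct).
    exists m.+1; have := chain_op (X := Y) (i := unbump i0 i) _ Ct.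
    by rewrite /Y unbumpK //; apply; apply: unbump_lt.
  - by exists v => //; exists 0%N; apply: FL0.
  by exists m; apply: chain_saturated Cm.
(* Simplicity applied to N + g S, which exceeds [N] because [g v] is outside the saturated [NT]. *)
have [||||a a0 [t Nt]] :=
    simpleN (W := [set s | exists t, N (s - g t)]) _ _ _ _ v.
- case: sN => N0 ND NZ; split=> [|s s' [t Ns] [t' Ns']|a s [t Ns]].
  + by exists 0; rewrite linear_op0 // subr0.
  + by exists (t + t'); rewrite lg.1 opprD addrACA; apply: ND.
  + by exists (a *: t); rewrite lg.2 -scalerBr; apply: NZ.
- by move=> s Ns; exists 0; rewrite linear_op0 // subr0.
- move=> i s lti [t Nt]; exists (X i t).
  have lXi := lX lti.
  have -> : g (X i t) = X i (g t).
    by rewrite /g euclid_op1_comm // => u; apply: XX.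
  by rewrite -linear_opB //; apply: XN.
- exists (g v); first by exists v; rewrite subrr; case: sN.
  by rewrite gE => /satNT Ngv; apply/vN/Ngv/monic_neq0.
have [m Cm] := chainS' t.
(* Modulo [N], [g t] is a multiple of [v], hence in [L0]; injectivity of [g] then brings [t] into
   [L0]. *)
have [b b0 [c Nbt]] : L0 t.
  apply: injL Cm _; rewrite -[g t](subKr (a *: v)); apply: submodule_sub => //.
    by case: sL0 => _ _; apply; apply: FL0.
  exact: (FL0 _ (NF _ _)).
have ba0 : (b * a)%:P != 0 :> {poly A}.
  by rewrite polyC_eq0; apply: ore_mulf_neq0.
have {Nt}Nt : NT ((b * a)%:P *: (v : T) - q *: (b%:P *: (t : T))).
  have NbZ : N (b *: (a *: v - g t)) by case: sN => _ _; apply.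
  rewrite -gE !polymod_scaleE !poly_actC lg.2 -scalerA.
  by rewrite scalerBr in NbZ.
have {Nbt}Nbt : NT (q *: (b%:P *: (t : T) - \sum_(i < k.+1) c i *: w i)).
  case: sNT => _ _; apply; rewrite polymod_scaleE poly_actC; exact: Nbt.
(* The coordinates of (b a) v - q (b t) in the family [w]. The one at [v] gives b a = q c_0, a
   nonzero constant divisible by [q]. *)
pose d i := if i == 0%N then (b * a)%:P - q * c 0%N else - (q * c i).
have Nsum : NT (\sum_(i < k.+1) d i *: w i).
  have -> : \sum_(i < k.+1) d i *: w i =
      ((b * a)%:P *: (v : T) - q *: (b%:P *: (t : T))) +
        q *: (b%:P *: (t : T) - \sum_(i < k.+1) c i *: w i).
    rewrite scalerBr addrA subrK scaler_sumr !big_ord_recl /= w0 scalerBl.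
    rewrite opprD scalerA addrA; congr (_ + _).
    by rewrite -sumrN; apply: eq_bigr => i _; rewrite scalerA scaleNr.
  by case: sNT => _ ND _; apply: ND.
have /eqP := wind d Nsum 0%N isT; rewrite /= subr_eq0 => /eqP baq.
have c0 : c 0%N != 0 by apply: contra_neq ba0; rewrite baq => ->; rewrite mulr0.
have := size_polyC_leq1 (b * a); rewrite baq size_monicM //.
move: qs; case: (size q) => [|[|sq]] // _.
by rewrite addSn /= addSn ltnS leqn0 addn_eq0 size_poly_eq0 (negPf c0) andbF.
Qed.

End TranscendentalOperator.

(** Once all operators are algebraic, a single [v] outside [N] lies in a stable, finitely generated
    saturated submodule, which simplicity makes everything. For n = 0 algebraicity is vacuous. *)
Theorem essentially_simple_finite n : finitely_generated_if_simple n.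
Proof.
have of_algebraic m (A : nzRingType) (S : lmodType A) (N : set S) (X : nat -> S -> S) :
    submodule N -> (forall i, (i < m)%N -> linear_op (X i)) ->
    (forall i j s, (i < m)%N -> (j < m)%N -> X i (X j s) = X j (X i s)) ->
    (forall i s, (i < m)%N -> N s -> N (X i s)) -> essentially_simple N m X ->
    (forall i s, (i < m)%N -> algebraic_at N (X i) s) ->
    exists U : seq S, forall s, satgen (N `|` [set` U]) s.
  move=> sN lX XX XN simpleN Xalg.
  have [Nfull|/existsNP [v Nv]] := pselect (forall s, N s).
    by exists [::] => s; apply: satgen_sub; left.
  have [U [Uv UX]] := algebraic_finite v sN lX XX XN Xalg; exists U => s.
  have [|||a a0] := simpleN (satgen (N `|` [set` U])) _ _ UX _ s.
  - exact: satgen_submodule.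
  - by move=> t Nt; apply: satgen_sub; left.
  - by exists v.
  exact: satgen_saturated.
elim: n => [|n IH] A S N X hA sN lX XX XN simpleN.
  by apply: (of_algebraic _ _ _ _ _ sN lX XX XN simpleN).
apply: (of_algebraic _ _ _ _ _ sN lX XX XN simpleN) => i v lti.
apply: contrapT => trv.
exact: (transcendental_absurd IH hA sN lX XX XN simpleN lti trv).
Qed.

(** * Maximal left ideals and contraction *)

Section MaximalSubmodules.
Variables (B : nzRingType) (S : lmodType B).
Implicit Types (L N W : set S).

Definition maximal_submodule L := [/\ submodule L, exists s, ~ L s &
  forall W, submodule W -> L `<=` W -> (exists2 w, W w & ~ L w) -> forall s, W s].

(** Zorn's lemma; generation by finitely many elements over [N] keeps the union of a chain
    proper. *)
Lemma exists_maximal_submodule N (U : seq S) :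
  submodule N -> (exists s, ~ N s) ->
  (forall W, submodule W -> N `<=` W -> {in U, forall u, W u} -> forall s, W s) ->
  exists2 L, maximal_submodule L & N `<=` L.
Proof.
move=> sN [s0 Ns0] NU.
pose good L := [/\ submodule L, N `<=` L & exists s, ~ L s].
have [F Fgood Ftot|L [[L0|[sL NL Lproper]] Lmax]] :=
    @Zorn_bigcup S [set L | L = set0 \/ good L].
- have [[L0 FL0 L0n]|Fempty] := pselect (exists2 L, F L & L != set0); last first.
    left; apply: bigcup0 => L FL; apply: contrapT => /eqP Ln.
    by apply: Fempty; exists L.
  have Fg L s : F L -> L s -> good L.
    by move=> FL Ls; case: (Fgood L FL) => // Le; rewrite Le in Ls.
  have gL0 : good L0 by case: (Fgood _ FL0) => // Le; rewrite Le eqxx in L0n.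
  case: (gL0) => sL0 NL0 _.
  have Fjoin L1 L2 s t : F L1 -> F L2 -> L1 s -> L2 t ->
      exists L, [/\ F L, L1 `<=` L, L s & L t].
    move=> FL1 FL2 Ls Lt; case: (Ftot _ _ FL1 FL2) => L12.
      by exists L2; split=> //; apply: L12.
    by exists L1; split=> //; apply: L12.
  right; split.
  + split=> [|u v [L1 FL1 Lu] [L2 FL2 Lv]|a u [L FL Lu]].
    * by exists L0 => //; case: sL0.
    * have [L [FL _ {}Lu {}Lv]] := Fjoin _ _ _ _ FL1 FL2 Lu Lv.
      by exists L => //; case: (Fg _ _ FL Lu) => -[_ LD _] _ _; apply: LD.
    * by exists L => //; case: (Fg _ _ FL Lu) => -[_ _ LZ] _ _; apply: LZ.
  + by move=> s Ns; exists L0 => //; apply: NL0.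
  apply: contrapT => /forallNP Ffull.
  (* If the union were everything, one member of the chain would already contain the finite list
     [U]. *)
  have [L [FL L0L LU]] : exists L, [/\ F L, L0 `<=` L & {in U, forall u, L u}].
    elim: (U) => [|u V [L [FL L0L LV]]]; first by exists L0; split.
    have [L1 FL1 L1u] := contrapT (Ffull u).
    have [L12|L12] := Ftot _ _ FL FL1.
      exists L1; split=> // [s /L0L /L12 //|w]; rewrite inE => /predU1P [-> //|/LV].
      exact: L12.
    exists L; split=> // w; rewrite inE => /predU1P [->|/LV //]; exact: L12.
  have L00 : L 0 by apply: L0L; case: sL0.
  case: (Fg _ _ FL L00) => sL NL [s]; apply; exact: NU.
- have := Lmax N; rewrite L0 => Nmax; exfalso; apply: Nmax; last first.
    by right; split=> //; exists s0.
  by split=> [s //|/(_ 0)]; apply; case: sN.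
exists L => //; split=> // W sW LW [w Ww Lw] s; apply: contrapT => Ws.
apply: (Lmax W); first by split=> // WL; apply/Lw/WL.
by right; split=> // [t /NL /LW //|]; exists s.
Qed.

Lemma maximal_submodule_cover L w t :
  maximal_submodule L -> ~ L w -> exists r, L (t - r *: w).
Proof.
case=> sL _ Lmax Lw; case: (sL) => L0 LD LZ.
apply: (Lmax [set t | exists r, L (t - r *: w)]).
- split=> [|u v [r Lu] [r' Lv]|a u [r Lu]].
  + by exists 0; rewrite scale0r subr0.
  + by exists (r + r'); rewrite scalerDl opprD addrACA; apply: LD.
  + by exists (a * r); rewrite -scalerA -scalerBr; apply: LZ.
- by move=> u Lu; exists 0; rewrite scale0r subr0.
- by exists w => //; exists 1; rewrite scale1r subrr.
Qed.

End MaximalSubmodules.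

Lemma left_ideal_one (B : nzRingType) (I : set B) :
  left_ideal I -> I 1 -> I = setT.
Proof.
by move=> [_ _ IM] I1; rewrite -subTset => s _; rewrite -[s]mulr1; apply: IM.
Qed.

Lemma exists_maximal_left_ideal (B : nzRingType) (I : set B) :
  left_ideal I -> ~ I 1 -> exists2 M, maximal_left_ideal M & I `<=` M.
Proof.
move=> sI I1; have [|W sW _ W1 s|M [sM [s Ms] Mmax] IM] :=
  @exists_maximal_submodule B B^o I [:: 1] sI.
- by exists 1.
- by rewrite (left_ideal_one (I := W) sW) //; apply: W1; rewrite inE.
exists M => //; split=> // [|J sJ MJ]; first by apply/eqP => MT; apply: Ms; rewrite MT.
have [JM|/existsNP [w /not_implyP [Jw Mw]]] := pselect (J `<=` M).
  by left; apply/seteqP.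
by right; rewrite -subTset => t _; apply: (Mmax J) => //; exists w.
Qed.

Section Contraction.
Variables (B : nzRingType) (N : set {poly B}).
Implicit Types (L W : set {poly B}) (U : seq {poly B}).
Hypothesis maxN : maximal_left_ideal N.

Let sN : left_ideal N. Proof. by case: maxN. Qed.

Lemma left_ideal_poly W :
  submodule W -> (forall s, W s -> W ('X * s)) -> left_ideal W.
Proof.
move=> [W0 WD WZ] WX; split=> // r; elim/poly_ind: r => [|p c IH] u Wu.
  by rewrite mul0r.
rewrite mulrDl -mulrA mul_polyC; apply: WD; last exact: WZ.
by apply: IH; apply: WX.
Qed.

Lemma left_ideal_submodule_poly : submodule N.
Proof. by case: sN => N0 ND NM; split=> // a u; rewrite -mul_polyC; apply: NM. Qed.

(** Multiplication by 'X embeds the quotient by this preimage into the simple quotient by [L]. *)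
Lemma maximal_submodule_mulX L : maximal_submodule L -> N `<=` L ->
  (exists s, ~ L ('X * s)) -> maximal_submodule [set s | L ('X * s)].
Proof.
move=> maxL NL proper; case: (maxL) => sL _ _.
have mulXZ a (u : {poly B}) : 'X * (a *: u) = a *: ('X * u).
  by rewrite -!mul_polyC mulrA -commr_polyX mulrA.
have lX : linear_op (fun s : {poly B} => 'X * s).
  by split=> [u v|a u]; rewrite ?mulrDr.
split=> //; first exact: submodule_preim.
move=> W sW LW [w Ww Lw] t.
have [r Lr] := maximal_submodule_cover ('X * t) maxL Lw.
rewrite -[t](subrK (r *: w)); case: (sW) => _ WD WZ; apply: WD; last exact: WZ.
by apply: LW; rewrite /= mulrBr mulXZ.
Qed.

(* The intersection of the maximal [B]-submodules above [N] is stable under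
   ['X], hence is [N]. *)
Lemma maximal_left_ideal_contraction U (b : B) :
  (forall W, submodule W -> N `<=` W -> {in U, forall u, W u} -> forall s, W s) ->
  ~ N b%:P ->
  exists M, [/\ maximal_left_ideal M, [set p | N p%:P] `<=` M & ~ M b].
Proof.
move=> NU Nb.
pose rad := [set s | forall L, maximal_submodule L -> N `<=` L -> L s].
have Nrad : N `<=` rad by move=> s Ns L _; apply.
have rad_ideal : left_ideal rad.
  apply: left_ideal_poly.
    split=> [L [[]]|u v ru rv L mL NL|a u ru L mL NL] //; case: (mL) => -[_ LD LZ] _ _.
      by apply: LD; [apply: ru|apply: rv].
    by apply: LZ; apply: ru.
  move=> s rs L mL NL.
  have [//|/existsNP proper] := pselect (forall t, L ('X * t)).
  apply: (rs [set s | L ('X * s)]); first exact: maximal_submodule_mulX.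
  by move=> u Nu; apply: NL; case: sN => _ _; apply.
have radN : rad = N.
  case: maxN => _ _ /(_ rad rad_ideal Nrad) [//|radT].
  have [|L mL NL] := exists_maximal_submodule left_ideal_submodule_poly _ NU.
    by exists b%:P.
  case: (mL) => _ [s Ls] _; case: Ls.
  have : rad s by rewrite radT.
  exact.
have [L [mL NL Lb]] : exists L, [/\ maximal_submodule L, N `<=` L & ~ L b%:P].
  apply: contrapT => H; apply: Nb; rewrite -radN => L mL NL.
  by apply: contrapT => Lb; apply: H; exists L.
case: (mL) => -[L0 LD LZ] _ _.
(* The quotient of [B] by this contraction embeds into the simple module {poly B} / L, so it is
   simple. *)
exists [set p | L p%:P]; split=> // [|p /NL //]; split.
- split=> [|u v Lu Lv|r u Lu] /=; first by rewrite polyC0.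
    by rewrite polyCD; apply: LD.
  by rewrite polyCM mul_polyC; apply: LZ.
- by apply/eqP => LT; apply: Lb; have : [set p | L p%:P] b by rewrite LT.
move=> J sJ LJ.
have [JL|/existsNP [j /not_implyP [Jj Lj]]] := pselect (J `<=` [set p | L p%:P]).
  by left; apply/seteqP.
right; apply: left_ideal_one => //; case: sJ => J0 JD JM.
have [r Lr] := maximal_submodule_cover 1 mL Lj.
rewrite -[1](subrK (r * j)); apply: JD; last exact: JM.
by apply: LJ; rewrite /= polyCB polyCM mul_polyC.
Qed.

End Contraction.

(** * The Rabinowitsch trick *)

Section Rabinowitsch.
Variables (B : nzRingType) (a : B).

(** Comparing coefficients gives a recurrence for those of [g]. The coefficient of index [size g]
    vanishes, which is an integral equation for [a]. *)
Lemma integral_of_rabinowitsch (P : set B) (p g : {poly B}) :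
  left_ideal P -> (forall i, P p`_i) -> 1 = p + g * (1 - a%:P * 'X) ->
  integral_over P a.
Proof.
move=> [P0 PD PM] Pp pg.
have gS i : g`_i.+1 = g`_i * a - p`_i.+1.
  move/polyP: pg => /(_ i.+1); rewrite coefD coef1 /= mulrBr mulr1 coefB mulrA.
  rewrite coefMX /= coefMC => pgi.
  by apply/eqP; rewrite -subr_eq0 opprB addrCA -pgi.
have g0 : g`_0 = 1 - p`_0.
  move/polyP: pg => /(_ 0%N); rewrite coefD coef1 /= mulrBr mulr1 coefB mulrA.
  rewrite coefMX /= subr0 => pg0.
  by apply/eqP; rewrite eq_sym subr_eq addrC; apply/eqP.
have gE k : g`_k = a ^+ k - \sum_(i < k.+1) p`_(k - i) * a ^+ i.
  elim: k => [|k IH]; first by rewrite big_ord1 subn0 expr0 mulr1.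
  rewrite gS IH mulrBl -exprSr mulr_suml [in RHS]big_ord_recl subn0 expr0 mulr1.
  rewrite opprD addrA addrAC; congr (_ - _ - _); apply: eq_bigr => i _.
  by rewrite -mulrA -exprSr subSS.
have := gE (size g); rewrite nth_default // => /esym /eqP; rewrite subr_eq0 => /eqP ak.
(* The relation [ak] involves [p`_0 * a ^+ size g]: one more factor [a] on the
   left makes it monic. *)
exists (size g).+1, (fun i => - (a * p`_(size g - i))); split=> // [i|].
  by rewrite -mulNr; apply: PM.
rewrite exprS ak mulr_sumr -big_split big1 //= => i _.
by rewrite mulrA mulNr subrr.
Qed.

(** Non-integrality makes P[y] + R[y] (1 - a y) proper. As a y = 1 modulo a maximal [N] above it, an
    integral equation over the contraction, multiplied by y^m, would put 1 in [N]. *)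
Lemma exists_rabinowitsch_maximal (P : set B) :
  left_ideal P -> ~ integral_over P a ->
  exists N : set {poly B}, [/\ maximal_left_ideal N, P `<=` [set p | N p%:P],
    left_ideal [set p | N p%:P] & ~ integral_over [set p | N p%:P] a].
Proof.
move=> sP aP; case: (sP) => P0 PD PM.
pose Q := [set f : {poly B} | exists p g : {poly B}, (forall i, P p`_i) /\
  f = p + g * (1 - a%:P * 'X)].
have sQ : left_ideal Q.
  split=> [|u v [p [g [Pp ->]]] [q [h [Pq ->]]]|r u [p [g [Pp ->]]]].
  - by exists 0, 0; rewrite mul0r addr0; split=> // i; rewrite coef0.
  - exists (p + q), (g + h); split=> [i|]; first by rewrite coefD; apply: PD.
    by rewrite mulrDl addrACA.
  - exists (r * p), (r * g); rewrite mulrDr mulrA; split=> // i.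
    rewrite coefM; apply: (big_ind P) => // j _; exact: PM.
have [|N mN QN] := exists_maximal_left_ideal sQ.
  by case=> p [g [Pp pg]]; apply: aP; apply: integral_of_rabinowitsch pg.
case: (mN) => sN NT _; case: (sN) => N0 ND NM.
exists N; split=> //.
- move=> p Pp; apply: QN; exists p%:P, 0; rewrite mul0r addr0; split=> // i.
  by rewrite coefC; case: eqP.
- split=> [|u v Nu Nv|r u Nu] /=; first by rewrite polyC0.
    by rewrite polyCD; apply: ND.
  by rewrite polyCM; apply: NM.
case=> m [r [m1 Nr]] /(congr1 polyC) ar.
have NB u v : N u -> N v -> N (u - v).
  by move=> Nu Nv; apply: ND => //; rewrite -mulN1r; apply: NM.
have Nax i f : N (f - f * (a%:P * 'X) ^+ i).
  elim: i => [|i IH]; first by rewrite mulr1 subrr.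
  rewrite -[f in f - _](subrK (f * (a%:P * 'X) ^+ i)) -addrA; apply: ND => //.
  rewrite exprSr mulrA -[X in X - _]mulr1 -mulrBr; apply: NM; apply: QN.
  exists 0, 1; rewrite add0r mul1r; split=> // i'; by rewrite coef0.
have axE i : (a%:P * 'X) ^+ i = (a ^+ i)%:P * 'X^i.
  by rewrite exprMn_comm ?rmorphXn //; apply: commr_polyX.
apply: (elimN eqP NT); apply: left_ideal_one => //.
move/(congr1 (fun f => f * 'X^m)): ar.
rewrite polyCD rmorph_sum /= mul0r mulrDl mulr_suml -axE => ar.
have := Nax m 1; rewrite mul1r => N1.
rewrite -[1](subrK ((a%:P * 'X) ^+ m)); apply: (ND) => //.
move/eqP: ar; rewrite addr_eq0 => /eqP ->; rewrite -sumrN.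
apply: (big_ind N) => // i _; rewrite -mulN1r; apply: (NM).
(* Written with [r i] to the left of (a y)^i, the term is congruent modulo the left ideal [N] to
   y^(m-i) r_i, which is in [N]. *)
have -> : (r i * a ^+ i)%:P * 'X^m = 'X^(m - i) * ((r i)%:P * (a%:P * 'X) ^+ i).
  rewrite axE -commr_polyXn polyCM -!mulrA -exprD subnKC //.
  exact/ltnW/ltn_ord.
apply: NM; rewrite -[_ * _](subKr (r i)%:P); apply: NB => //; exact: Nr.
Qed.

End Rabinowitsch.

(** Integrality of 1 over a left ideal amounts to membership of 1. *)
Lemma maximal_left_ideal_G (B : nzRingType) (M : set B) :
  maximal_left_ideal M -> G_left_ideal M.
Proof.
case=> sM MT Mmax; split=> //; exists 1; split.
  case=> m [r [_ Mr]]; rewrite expr1n => /eqP; rewrite addr_eq0 => /eqP r1.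
  apply: (elimN eqP MT); apply: left_ideal_one => //; rewrite r1 -mulN1r.
  case: sM => M0 MD MM; apply: MM; apply: (big_ind M) => // i _.
  by rewrite expr1n mulr1; apply: Mr.
move=> J sJ MJ; have [JM|->] := Mmax J sJ (properW MJ).
  by move: MJ; rewrite JM => /properxx.
by exists 1%N, (fun=> -1); split=> //; rewrite big_ord1 !expr1n mulr1 subrr.
Qed.

(** * The ring D[x_1, ..., x_n][y] as a module over D *)

Definition mpoly_poly (D : nzRingType) n : Type := {poly {mpoly D[n]}}.

Section MpolyPoly.
Variables (D : unitRingType) (n : nat).
Implicit Types (f s : {poly {mpoly D[n]}}).

HB.instance Definition _ := GRing.Zmodule.copy (mpoly_poly D n) {poly {mpoly D[n]}}.

(** The alias [mpoly_poly] keeps this action of [D] apart from the module structure over [{mpoly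
    D[n]}]. *)
Let scale (c : D) (f : mpoly_poly D n) : mpoly_poly D n :=
  c%:MP *: (f : {poly {mpoly D[n]}}).

Fact mpoly_poly_scalerA c d f : scale c (scale d f) = scale (c * d) f.
Proof. by rewrite /scale scalerA mpolyCM. Qed.

Fact mpoly_poly_scale1r f : scale 1 f = f.
Proof. exact: scale1r. Qed.

Fact mpoly_poly_scalerDr c (f s : mpoly_poly D n) :
  scale c (f + s) = scale c f + scale c s.
Proof. exact: scalerDr. Qed.

Fact mpoly_poly_scalerDl (f : mpoly_poly D n) (c d : D) :
  scale (c + d) f = scale c f + scale d f.
Proof. by rewrite /scale mpolyCD; apply: scalerDl. Qed.

HB.instance Definition _ := @GRing.Zmodule_isLmodule.Build D (mpoly_poly D n) scale
  mpoly_poly_scalerA mpoly_poly_scale1r mpoly_poly_scalerDr mpoly_poly_scalerDl.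

Lemma mpoly_poly_scaleE (c : D) (f : mpoly_poly D n) :
  c *: f = c%:MP%:P * (f : {poly {mpoly D[n]}}).
Proof. by rewrite mul_polyC. Qed.

(** The n + 1 commuting operators: index n stands for y, smaller ones for the x_i. *)
Definition mpoly_poly_var k : {poly {mpoly D[n]}} :=
  if insub k is Some i then ('X_i)%:P else 'X.

Lemma mpoly_poly_var_comm k f : mpoly_poly_var k * f = f * mpoly_poly_var k.
Proof.
rewrite /mpoly_poly_var; case: insubP => [i _ _|_]; last by rewrite commr_polyX.
by apply/polyP => j; rewrite coefCM coefMC commr_mpolyX.
Qed.

Lemma mpoly_poly_left_ideal (W : set (mpoly_poly D n)) :
  submodule W ->
  (forall k s, (k < n.+1)%N -> W s -> W (mpoly_poly_var k * s)) ->
  @left_ideal {poly {mpoly D[n]}} W.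
Proof.
move=> [W0 WD WZ] WX.
have WX_ (m : 'X_{1..n}) s : W s -> W ('X_[m]%:P * s).
  rewrite mpolyXE_id; elim/big_ind: _ s => [s|p q IHp IHq s Ws|i _ s].
  - by rewrite mul1r.
  - by rewrite polyCM -mulrA; apply: IHp; apply: IHq.
  elim: (m i) s => [|e IH] s Ws; first by rewrite mul1r.
  rewrite exprS polyCM -mulrA.
  have := WX i _ (ltnW (ltn_ord i)) (IH s Ws).
  by rewrite /mpoly_poly_var valK.
apply: left_ideal_poly => [|s Ws]; last first.
  have := WX n s (ltnSn n) Ws; rewrite /mpoly_poly_var insubF //.
  by rewrite ltnn.
split=> // p u Wu; rewrite -mul_polyC; elim/mpolyind: p => [|c m p _ _ IH].
  by rewrite polyC0 mul0r.
have -> : (c *: 'X_[m] + p)%:P * u = c%:MP *: ('X_[m]%:P * u) + p%:P * u.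
  by rewrite -mul_polyC mulrA -[in RHS]mulrDl -mul_mpolyC -rmorphM -rmorphD.
by apply: WD => //; apply: (WZ c); apply: WX_.
Qed.

(** Maximality of [N] is simplicity under the n + 1 variables. Nonzero scalars of [D] are units, so
    submodules are saturated, and generators over [D] also generate over [{mpoly D[n]}]. *)
Lemma maximal_left_ideal_finite (N : set {poly {mpoly D[n]}}) :
  division_ring D -> maximal_left_ideal N ->
  exists U : seq {poly {mpoly D[n]}},
    forall W : set {poly {mpoly D[n]}}, submodule W -> N `<=` W ->
      {in U, forall u, W u} -> forall s, W s.
Proof.
move=> hD [sN NT Nmax]; case: (sN) => N0 ND NM; pose S := mpoly_poly D n.
have sND : @submodule D S N.
  by split=> // c u; rewrite mpoly_poly_scaleE; apply: NM.
have [||||U NU] := @essentially_simple_finite n.+1 D S N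
  (fun k s => mpoly_poly_var k * s) (division_ring_ore hD) sND.
- move=> k _; split=> [u v|c u]; first by rewrite mulrDr.
  by rewrite !mpoly_poly_scaleE mulrA mpoly_poly_var_comm mulrA.
- by move=> i j s _ _; rewrite mulrA mpoly_poly_var_comm mulrA.
- by move=> k s _; apply: NM.
- move=> W sW NW WX [w Ww Nw] s; apply: sub_sat.
  have [WN|->//] := Nmax W (mpoly_poly_left_ideal sW WX) NW.
  by rewrite WN in Ww.
exists U => W [W0 WD WZ] NW WU s; apply: (NU s W).
- by split=> // c u; rewrite mpoly_poly_scaleE mul_polyC; apply: WZ.
- move=> c u c0; rewrite mpoly_poly_scaleE mul_polyC => /(WZ c^-1%:MP).
  by rewrite scalerA -mpolyCM mulVr ?hD // mpolyC1 scale1r.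
- by move=> u [/NW|/WU].
Qed.

End MpolyPoly.

Theorem theorem1p8 (D : unitRingType) (hD : division_ring D)
    (n : nat) (hn : (1 <= n)%N)
    (I : set {mpoly D[n]}) (hI : left_ideal I) :
  \bigcap_(M in [set M | maximal_left_ideal M /\ I `<=` M]) M
  = \bigcap_(P in [set P | G_left_ideal P /\ I `<=` P]) P.
Proof.
apply/seteqP; split=> [s sM P [[sP [a [aP Pmax]]] IP]|s sP M [mM IM]]; last first.
  by apply: sP; split=> //; apply: maximal_left_ideal_G.
have [N [mN PN sNP aN]] := exists_rabinowitsch_maximal sP aP.
(* Were the contraction strictly larger than [P], the witness [a] would be integral over it. *)
have NP : [set p | N p%:P] `<=` P.
  by apply: contrapT => NP; apply: aN; apply: Pmax.
have [U NU] := maximal_left_ideal_finite hD mN.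
apply: contrapT => Ps.
have [|M [mM NM Ms]] := maximal_left_ideal_contraction mN (b := s) NU.
  by move=> Ns; apply/Ps/NP.
by apply: Ms; apply: sM; split=> // t It; apply/NM/PN/IP.
Qed.
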